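(* Let $a>0$ and $b\in(0,1)$. For every periodic orbit $\{x_0,x_1,\dots,x_{n-1}\}$ of $f_{a,b}$ contained in $(0,1)$ (of period $n\ge 1$), its center of mass $$\frac{x_0+x_1+\dots+x_{n-1}}{n}$$ is equal to $b$.
   Context: For real $a>0$ and $b\in(0,1)$, the map $f_{a,b}:[0,1]\to[0,1]$ is defined by $$f_{a,b}(x)=\frac{x}{x+(1-x)\exp(a(x-b))}.$$ A periodic orbit of period $n$ is a set of $n$ distinct points $x_0,\dots,x_{n-1}$ with $f_{a,b}(x_i)=x_{i+1}$ for $0\le i<n-1$ and $f_{a,b}(x_{n-1})=x_0$. *)

(* Defs.v *)
From mathcomp Require Import all_boot all_order all_algebra.
From mathcomp Require Import all_classical all_reals all_analysis.

Set Implicit Arguments.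
Unset Strict Implicit.
Unset Printing Implicit Defensive.

Import Order.TTheory GRing.Theory Num.Theory.
Local Open Scope ring_scope.

(* The formula is used on all of R; it is the intended self-map only on [0, 1]
   (see fab_itv), where the denominator is positive. *)
Definition fab (R : realType) (a b x : R) : R :=
  x / (x + (1 - x) * expR (a * (x - b))).

Lemma fab_den_gt0 (R : realType) (a b x : R) :
  0 <= x <= 1 -> 0 < x + (1 - x) * expR (a * (x - b)).
Proof.
move=> /andP[x0 x1]; have e0 := expR_gt0 (a * (x - b)).
move: x0; rewrite le_eqVlt => /predU1P[<-|x0].
  by rewrite add0r subr0 mul1r expR_gt0.
by rewrite ltr_wpDr // mulr_ge0 ?subr_ge0 // ltW.
Qed.

Lemma fab_itv (R : realType) (a b x : R) :
  0 <= x <= 1 -> 0 <= fab a b x <= 1.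
Proof.
move=> x01; have d0 := fab_den_gt0 a b x01; case/andP: x01 => x0 x1.
rewrite /fab divr_ge0 ?(ltW d0) //= ler_pdivrMr // mul1r lerDl.
by rewrite mulr_ge0 ?subr_ge0 // expR_ge0.
Qed.

(* ordS i is i + 1 for i < n - 1 and wraps n - 1 around to 0.  Period 0 is
   excluded. *)
Definition periodic_orbit (T : Type) (f : T -> T) (n : nat) (x : 'I_n -> T) :
    Prop :=
  [/\ (0 < n)%N, injective x & forall i : 'I_n, f (x i) = x (ordS i)].

(* Main.v *)
(** Along the map, the log-odds [ln ((1 - x) / x)] increases by exactly
    [a * (x - b)]; summed over a periodic orbit these increments cancel. *)
Require Import Defs.
From mathcomp Require Import all_boot all_order all_algebra.
From mathcomp Require Import all_classical all_reals all_analysis.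
From mathcomp Require Import ring.

Import Order.TTheory GRing.Theory Num.Theory.
Local Open Scope ring_scope.

(** One application of [fab a b] multiplies the odds [(1 - x) / x] by [expR (a * (x - b))], so by
    [ln_odds_fab] their logarithm grows by [a * (x - b)]. Around a cycle the total growth is zero,
    and dividing by [a] shows that the deviations from [b] sum to zero. *)

Lemma odds_fab (R : realType) (a b x : R) : 0 < x < 1 ->
  (1 - fab a b x) / fab a b x = (1 - x) / x * expR (a * (x - b)).
Proof.
move=> /andP[x0 x1].
have := @fab_den_gt0 R a b x; rewrite !ltW // => /(_ isT) d0.
rewrite /fab; field.
by rewrite !gt_eqF.
Qed.

Lemma ln_odds_fab (R : realType) (a b x : R) : 0 < x < 1 ->
  ln ((1 - fab a b x) / fab a b x) = ln ((1 - x) / x) + a * (x - b).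
Proof.
move=> x01; rewrite odds_fab // lnM ?posrE ?expR_gt0 ?expRK //.
by case/andP: x01 => x0 x1; rewrite divr_gt0 // subr_gt0.
Qed.

Theorem corollary3p5 (R : realType) (a b : R) (a_gt0 : 0 < a)
  (b01 : 0 < b < 1) (n : nat) (x : 'I_n -> R)
  (x_orbit : periodic_orbit (fab a b) x)
  (x01 : forall i : 'I_n, 0 < x i < 1) :
  (\sum_(i < n) x i) / n%:R = b.
Proof.
have [n_gt0 _ fx] := x_orbit.
pose L i := ln ((1 - x i) / x i).
have LS i : L (ordS i) = L i + a * (x i - b) by rewrite /L -fx ln_odds_fab.
(* The cyclic shift [ordS] permutes the indices. *)
have : \sum_i L (ordS i) = \sum_i L i.
  by rewrite [RHS](reindex_inj (@ordS_inj n)).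
(* Cancelling [\sum_i L i] leaves the sum of the increments equal to 0. *)
rewrite (eq_bigr _ (fun i _ => LS i)) big_split /= -[RHS]addr0 => /addrI.
rewrite -mulr_sumr => /eqP; rewrite mulf_eq0 gt_eqF //= sumrB subr_eq0.
rewrite sumr_const card_ord => /eqP ->.
by rewrite -[b *+ n]mulr_natr mulfK // pnatr_eq0 -lt0n.
Qed.
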